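(* Let $N \geq 2$ and $M \geq 1$ be integers, and let $F(X_1,\dots,X_N) \in \mathbb{Z}[X_1,\dots,X_N]$ be a non-zero homogeneous polynomial in $N$ variables of degree $M$. Then there exists a point $\boldsymbol{x} \in \mathbb{Z}^N$ such that $F(\boldsymbol{x}) \neq 0$ and $$\mathcal{L}(\boldsymbol{x}) \leq \left[ \frac{M+2}{2}\ \min \left\{ N, \frac{M+2}{4} \right\} \right].$$
   Context: For $\boldsymbol{x}=(x_1,\dots,x_N)\in\mathbb{Z}^N$, the length is $\mathcal{L}(\boldsymbol{x})=\sum_{i=1}^N|x_i|$. For a real number $t$, $[t]$ denotes its integer part. *)

(* Defs.v *)
From mathcomp Require Import all_boot all_order all_algebra.

Set Implicit Arguments.
Unset Strict Implicit.
Unset Printing Implicit Defensive.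

Import Order.TTheory GRing.Theory Num.Theory.

Local Open Scope ring_scope.

Definition point_length (N : nat) (x : 'I_N -> int) : int := \sum_(i < N) `|x i|.

(* Main.v *)
Require Import Defs.
From mathcomp Require Import all_boot all_order all_algebra.
From mathcomp Require Import mpoly.
From mathcomp Require Import lra.

Import Order.TTheory GRing.Theory Num.Theory.

Local Open Scope ring_scope.

(** Take a monomial X^a of F. Since F is homogeneous, every other monomial X^b
    of F has b_i < a_i for some i. Linear functionals that combine the values at
    0, ..., a_i and kill 1, X, ..., X^(a_i - 1) but not X^(a_i) therefore isolate,
    once multiplied over i, the coefficient of X^a; so F does not vanish on the
    whole grid prod_i {0, ..., a_i}, whose points have length at most M. Finally
    8 M <= (M + 2)^2 and 2 M <= N (M + 2). *)

(** The weights are the last column of the adjugate of the Vandermonde matrix [V]: by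
    [V *m \adj V = (\det V)%:M] the sums are 0 for [b < a] and [\det V] for [b = a]. The adjugate
    avoids division, as [R] is only a domain. *)
Lemma exists_leading_coef_weights (R : idomainType) (s : nat -> R) (a : nat) :
  injective s ->
  exists w : nat -> R,
    (forall b, (b < a)%N -> \sum_(j < a.+1) w j * s j ^+ b = 0) /\
    \sum_(j < a.+1) w j * s j ^+ a != 0.
Proof.
move=> s_inj; pose V : 'M_a.+1 := Vandermonde a.+1 (\row_j s j).
exists (fun j => (\adj V) (inord j) ord_max).
have wE (b : 'I_a.+1) :
    \sum_(j < a.+1) (\adj V) (inord j) ord_max * s j ^+ b
    = \det V *+ (b == ord_max).
  have /matrixP/(_ b ord_max) := mul_mx_adj V; rewrite !mxE => <-.
  by apply: eq_bigr => j _; rewrite inord_val !mxE mulrC.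
split=> [b ltba|].
  by rewrite (wE (Ordinal (ltnW ltba : (b < a.+1)%N))) -val_eqE /= ltn_eqF.
rewrite (wE ord_max) eqxx det_Vandermonde; apply/prodf_neq0 => i _.
apply/prodf_neq0 => j ltij; rewrite !mxE subr_eq0 (inj_eq s_inj).
by rewrite gtn_eqF.
Qed.

(** Otherwise [m] divides [m'], and the quotient has degree 0. *)
Lemma mdeg_eq_exists_lt (n : nat) (m m' : 'X_{1..n}) :
  mdeg m' = mdeg m -> m' != m -> exists i, (m' i < m i)%N.
Proof.
move=> eq_deg neq_m; apply/existsP; apply: contraNT neq_m.
rewrite negb_exists => /forallP no_lt.
have lemm' : (m <= m')%MM by apply/mnm_lepP => i; rewrite leqNgt.
have m'E := submK lemm'.
have /eqP : mdeg (m' - m)%MM = 0%N.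
  by apply: (@addIn (mdeg m)); rewrite -mdegD m'E eq_deg.
by rewrite mdeg_eq0 => /eqP sub0; rewrite -m'E sub0 add0m.
Qed.

Lemma dhomog_neq0_on_grid (R : idomainType) (s : nat -> R) (n d : nat)
    (p : {mpoly R[n]}) (m : 'X_{1..n}) :
  injective s -> p \is d.-homog -> m \in msupp p ->
  exists x : 'I_n -> nat, (forall i, (x i <= m i)%N) /\ p.@[s \o x] != 0.
Proof.
move=> s_inj p_homog mp.
have /fin_all_exists[w wP] i := @exists_leading_coef_weights R s (m i) s_inj.
(* The bound [mdeg m] dominates every [m i], so all coordinates share one finite type; [Q i] cuts
   out the i-th side of the grid. *)
pose Q i := [pred j : 'I_(mdeg m).+1 | (j <= m i)%N].
have sumQ i (b : nat) : \sum_(j in Q i) w i j * s j ^+ b =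
    \sum_(j < (m i).+1) w i j * s j ^+ b.
  have le_mi : ((m i).+1 <= (mdeg m).+1)%N.
    by rewrite ltnS mdegE (bigD1 i) //= leq_addr.
  by rewrite (big_ord_widen _ (fun j => w i j * s j ^+ b) le_mi).
have [x] : exists x : {ffun 'I_n -> 'I_(mdeg m).+1},
    (x \in family Q) && (p.@[fun i => s (x i)] != 0).
  apply/existsP; apply: contraT => /existsPn vanish.
  have : \sum_(x in family Q)
      (\prod_i w i (x i)) * p.@[fun i => s (x i)] = 0.
    apply: big1 => x xQ; have := vanish x; rewrite xQ /= negbK => /eqP ->.
    by rewrite mulr0.
  under eq_bigr do rewrite mevalE mulr_sumr.
  rewrite exchange_big /= (bigD1_seq m) ?msupp_uniq //=.
  (* On each monomial the weighted grid sum factors into one-variable sums. *)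
  have monomE b : \sum_(x in family Q)
      (\prod_i w i (x i)) * (p@_b * \prod_i s (x i) ^+ b i) =
      p@_b * \prod_i \sum_(j < (m i).+1) w i j * s j ^+ b i.
    under [in RHS]eq_bigr do rewrite -sumQ.
    rewrite bigA_distr_big_dep mulr_sumr; apply: eq_bigr => x _.
    by rewrite big_split /= mulrCA.
  (* For [b != m] some factor has [b i < m i], hence is 0; the term of [m] is a product of nonzero
     factors. *)
  rewrite [X in _ + X]big_seq_cond [X in _ + X]big1 ?addr0 => [|b /andP[bp neq_bm]].
    rewrite monomE => /eqP; rewrite mulf_eq0.
    rewrite mcoeff_msupp in mp; rewrite (negPf mp) /=.
    by move=> /prodf_eq0[i _]; rewrite (negPf (wP i).2).
  have eq_deg : mdeg b = mdeg m by rewrite !(dhomogP _ _ _ p_homog).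
  have [i lti] := mdeg_eq_exists_lt _ _ _ eq_deg neq_bm.
  by rewrite monomE (bigD1 i) //= (wP i).1 // mul0r mulr0.
move=> /andP[/familyP xQ px]; exists (fun i => x i); split=> // i; exact: xQ.
Qed.

Theorem proposition2p4 (N M : nat) (hN : (2 <= N)%N) (hM : (1 <= M)%N)
    (F : {mpoly int[N]}) (F_neq0 : F != 0) (F_homog : F \is M.-homog) :
  exists x : 'I_N -> int,
    F.@[x] != 0 /\
    point_length x <=
      Num.floor ((M%:R + 2) / 2 * Num.min N%:R ((M%:R + 2) / 4) : rat).
Proof.
have Fm : mlead F \in msupp F by rewrite mlead_supp.
have degF : mdeg (mlead F) = M := dhomogP _ _ _ F_homog _ Fm.
have Posz_inj : injective Posz by move=> ? ? [].
have [x [le_x Fx]] := dhomog_neq0_on_grid _ _ _ _ _ _ Posz_inj F_homog Fm.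
exists (Posz \o x); split=> //.
have le_M : point_length (Posz \o x) <= M%:Z.
  rewrite -degF mdegE -natz natr_sum.
  by apply: ler_sum => i _; rewrite /= natz lez_nat le_x.
rewrite (le_trans le_M) // floor_ge_int -pmulrn.
have N2 : 2 <= N%:R :> rat by rewrite ler_nat.
have M0 : 0 <= M%:R :> rat by rewrite ler0n.
(* This square is [(M + 2)^2 - 8 M], which settles the case where the minimum is [(M + 2) / 4]. *)
have sq0 : 0 <= (M%:R - 2) ^+ 2 :> rat by rewrite sqr_ge0.
by rewrite minEle; case: ifP => _; nra.
Qed.
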